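(* Let $S_k^d=\{\mathbf z\in\{0,1\}^d:\sum_{p=1}^d z_p\le k\}$ and, for $\mathbf z\in S_k^d$, let $\mathbf Z=\mathrm{diag}(\mathbf z)$. Consider the problem $\min_{\mathbf z\in S_k^d} g(\mathbf z)$, where $$\begin{aligned} g(\mathbf z)=\min_{\boldsymbol\beta,\boldsymbol\theta,\xi,\xi^*}\quad & \frac12\sum_{i=1}^n\|\boldsymbol\beta_i\|_2^2+C\sum_{i=1}^n\bigl(\tau\xi_i+(1-\tau)\xi_i^*\bigr)\\ \text{s.t.}\quad & y_i-\theta_i\le\xi_i\quad\forall i\in[n],\\ & \theta_i-y_i\le\xi_i^*\quad\forall i\in[n],\\ & \theta_i+\boldsymbol\beta_i'\mathbf Z(\mathbf x_j-\mathbf x_i)\le\theta_j\quad\forall i,j\in[n],\\ & \xi_i\ge0,\quad \xi_i^*\ge0\quad\forall i\in[n]. \end{aligned}$$ This problem is equivalent to solving the following formulation with binary variables and convex objective: $$\min_{\mathbf z\in S_k^d}\ g(\mathbf z),$$ where $$\begin{aligned} g(\mathbf z)=\max_{\lambda,\lambda^*,\mu}\quad & -\frac12\sum_{i=1}^n\Bigl\|\sum_{j=1}^n\mu_{ij}\mathbf Z(\mathbf x_j-\mathbf x_i)\Bigr\|_2^2+\sum_{i=1}^n\lambda_iy_i-\sum_{i=1}^n\lambda_i^*y_i\\ \text{s.t.}\quad & -\lambda_i+\lambda_i^*+\sum_{j=1}^n\mu_{ij}-\sum_{j=1}^n\mu_{ji}=0\quad\forall i\in[n],\\ & 0\le\lambda_i\le\tau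 C\quad\forall i\in[n],\\ & 0\le\lambda_i^*\le(1-\tau)C\quad\forall i\in[n],\\ & \mu_{ij}\ge0\quad\forall i,j\in[n]. \end{aligned}$$
   Context: Notation: $[n]=\{1,\dots,n\}$; a prime denotes transpose; $\mathrm{diag}(\mathbf z)$ is the diagonal matrix with diagonal $\mathbf z$. The data are $(\mathbf x_i,y_i)$, $i\in[n]$, with $\mathbf x_i\in\mathbb R^d$ and $y_i\in\mathbb R$. The parameters are a quantile level $\tau\in(0,1)$, a penalty coefficient $C>0$ and a given sparsity level $k$ (the maximum number of selected features). The variables of the inner minimization are $\boldsymbol\beta_i\in\mathbb R^d$ and $\theta_i,\xi_i,\xi_i^*\in\mathbb R$ for $i\in[n]$; those of the inner maximization are $\lambda_i,\lambda_i^*,\mu_{ij}\in\mathbb R$ for $i,j\in[n]$. *)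

(* Defs.v *)
(* MathComp-Analysis; all norms are spelled out because the library norm on
   matrices is the sup norm. *)
From mathcomp Require Import all_boot all_order all_algebra.
From mathcomp Require Import all_classical all_reals all_analysis.

Set Implicit Arguments.
Unset Strict Implicit.
Unset Printing Implicit Defensive.

Import Order.TTheory GRing.Theory Num.Theory.
Local Open Scope classical_set_scope.
Local Open Scope ring_scope.

Definition sqnorm2 (R : realType) (d : nat) (u : 'cV[R]_d) : R :=
  \sum_(p < d) u p 0 ^+ 2.

Definition is_min (R : realType) (A : set R) (v : R) : Prop := A v /\ lbound A v.
Definition is_max (R : realType) (A : set R) (v : R) : Prop := A v /\ ubound A v.

Definition argmin (R : realType) (T : Type) (S : set T) (f : T -> R) : set T :=
  [set z | S z /\ forall z', S z' -> f z <= f z'].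

(* Binary vectors are kept as real vectors, so that the value functions below
   are defined on all of R^d. *)
Definition sparse_binary (R : realType) (d k : nat) : set 'rV[R]_d :=
  [set z | (forall p, z 0 p = 0 \/ z 0 p = 1) /\ \sum_(p < d) z 0 p <= k%:R].

Definition unit_box (R : realType) (d : nat) : set 'rV[R]_d :=
  [set z | forall p, 0 <= z 0 p <= 1].

Section Problems.
Variables (R : realType) (n d : nat).
Variables (x : 'I_n -> 'cV[R]_d) (y : 'I_n -> R) (tau C : R).

Definition primal_feasible (z : 'rV[R]_d) (beta : 'I_n -> 'cV[R]_d)
    (theta xi xis : 'I_n -> R) : Prop :=
  [/\ forall i, y i - theta i <= xi i,
      forall i, theta i - y i <= xis i,
      forall i j,
        theta i + ((beta i)^T *m diag_mx z *m (x j - x i)) 0 0 <= theta j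
    & forall i, 0 <= xi i /\ 0 <= xis i].

Definition primal_obj (beta : 'I_n -> 'cV[R]_d) (xi xis : 'I_n -> R) : R :=
  2^-1 * \sum_(i < n) sqnorm2 (beta i)
  + C * \sum_(i < n) (tau * xi i + (1 - tau) * xis i).

Definition primal_values (z : 'rV[R]_d) : set R :=
  [set v | exists beta theta xi xis,
     primal_feasible z beta theta xi xis /\ v = primal_obj beta xi xis].

Definition g_primal (z : 'rV[R]_d) : R := inf (primal_values z).

Definition dual_feasible (lam lams : 'I_n -> R) (mu : 'M[R]_n) : Prop :=
  [/\ forall i,
        - lam i + lams i + \sum_(j < n) mu i j - \sum_(j < n) mu j i = 0,
      forall i, 0 <= lam i <= tau * C,
      forall i, 0 <= lams i <= (1 - tau) * C
    & forall i j, 0 <= mu i j].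

Definition dual_obj (z : 'rV[R]_d) (lam lams : 'I_n -> R) (mu : 'M[R]_n) : R :=
  - 2^-1 * \sum_(i < n)
      sqnorm2 (\sum_(j < n) mu i j *: (diag_mx z *m (x j - x i)))
  + \sum_(i < n) lam i * y i - \sum_(i < n) lams i * y i.

Definition dual_values (z : 'rV[R]_d) : set R :=
  [set v | exists lam lams mu,
     dual_feasible lam lams mu /\ v = dual_obj z lam lams mu].

Definition g_dual (z : 'rV[R]_d) : R := sup (dual_values z).

(* For binary z one has Z'Z = Z, so |Z w|^2 = w' Z w; the right-hand side is
   linear in z.  On fractional z the two expressions differ, and g_dual itself
   is in general not convex on the unit box: the convex objective is the
   maximum of these functions, which are affine in z. *)
Definition dual_obj_lin (z : 'rV[R]_d) (lam lams : 'I_n -> R) (mu : 'M[R]_n) : R :=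
  - 2^-1 * \sum_(i < n)
      (let w := \sum_(j < n) mu i j *: (x j - x i) in
       (w^T *m diag_mx z *m w) 0 0)
  + \sum_(i < n) lam i * y i - \sum_(i < n) lams i * y i.

Definition dual_values_lin (z : 'rV[R]_d) : set R :=
  [set v | exists lam lams mu,
     dual_feasible lam lams mu /\ v = dual_obj_lin z lam lams mu].

Definition g_dual_lin (z : 'rV[R]_d) : R := sup (dual_values_lin z).

End Problems.

(* Main.v *)
Require Import Defs.
From mathcomp Require Import all_boot all_order all_algebra.
From mathcomp Require Import all_classical all_reals all_analysis.
From mathcomp Require Import ring lra.
Import Order.TTheory GRing.Theory Num.Theory.
Import numFieldNormedType.Exports.
Local Open Scope classical_set_scope.
Local Open Scope ring_scope.

(** Everything rests on strong duality, with attainment on both sides, for the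
    inner convex quadratic program; it holds for every real vector z, not only
    for the binary ones ([strong_duality]).

    The difference between a primal and a dual objective, once the flow
    equation of the dual is imposed, is a sum of products of a multiplier with
    the slack of its constraint, plus half the squares of
    beta_i + sum_j mu_ij Z (x_j - x_i) ([duality_gap]).  For feasible points
    every term is nonnegative, which is weak duality.  A primal minimizer
    exists by compactness: since C > 0 and 0 < tau < 1, a bound on the objective
    bounds beta, xi and xi*, and y_i - xi_i <= theta_i <= y_i + xi*_i then
    bounds theta ([sublevel_bounded], [primal_attained]).  At a minimizer no
    direction that respects the active constraints decreases the objective to
    first order, so Farkas' lemma writes minus the gradient as a nonnegative
    combination of the active constraints ([farkas_seq], [kkt]).  The multipliers
    of the constraints on y - theta, theta - y and on the slopes form a dual
    feasible point, the other two families being the slacks of the upper bounds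
    on lambda and lambda*, and every term of the gap vanishes ([optimal_pair]).

    The primal and dual value functions being equal, the outer problems have
    the same minimizers, and the minimum exists because S is finite.

    For the convex form, the norm of Z w squared is linear in a binary z, since
    z_p ^ 2 = z_p, and equals sum_p z_p w_p ^ 2.  Extended to the unit box by
    the latter formula, the dual objective is affine in z for each dual point,
    and the dual feasible set does not depend on z; so its maximum over the
    dual points is convex.  That this maximum is attained is again strong
    duality, for the data sqrt(Z) x_i and the all-ones vector
    ([dual_obj_lin_scaled]). *)

Set Implicit Arguments.
Unset Strict Implicit.
Unset Printing Implicit Defensive.

(** * Linear forms, Farkas lemma and first-order optimality *)

Section ScalarForms.
Variables (R : pzRingType) (V : lmodType R) (f : V -> R).
Hypothesis f_lin : scalar f.

Lemma scalarZ t u : f (t *: u) = t * f u.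
Proof.
have f0 : f 0 = 0.
  have := f_lin 1 0 0; rewrite scaler0 mul1r addr0 => /esym/eqP.
  by rewrite -subr_eq0 addrK => /eqP.
by have := f_lin t u 0; rewrite !addr0 f0 addr0.
Qed.

Lemma scalarD u v : f (u + v) = f u + f v.
Proof. by have := f_lin 1 u v; rewrite scale1r mul1r. Qed.

Lemma scalarBZ u t v : f (u - t *: v) = f u - t * f v.
Proof. by rewrite scalarD -scaleNr scalarZ mulNr. Qed.

End ScalarForms.

(** Bartl's algebraic proof: induction on the number of forms, with no
    separation theorem.  If the form [a k] matters, there is [u] in the cone of
    the others with [c u > 0], hence [a k u > 0]; projecting along [u] onto the
    kernel of [a k] removes that form, and the coefficient of [a k] is
    recovered by evaluating at [u]. *)
Lemma farkas_seq (R : realFieldType) (V : lmodType R) (J : eqType)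
    (s : seq J) (a : J -> V -> R) (c : V -> R) :
  uniq s -> (forall j, scalar (a j)) -> scalar c ->
  (forall h, (forall j, j \in s -> a j h <= 0) -> c h <= 0) ->
  exists2 lam : J -> R, forall j, 0 <= lam j &
    forall h, c h = \sum_(j <- s) lam j * a j h.
Proof.
elim: s a c => [|k s IHs] a c /= => [_|/andP[ks us]] a_lin c_lin cone_le0.
  exists (fun=> 0) => // h; rewrite big_nil.
  have c_le0 u : c u <= 0 by exact: cone_le0.
  apply/le_anti; rewrite c_le0 /=.
  by have := c_le0 (- h); rewrite -scaleN1r (scalarZ c_lin) mulN1r oppr_le0.
have sum_upd (lam : J -> R) t h : \sum_(j <- k :: s)
    (if j == k then t else lam j) * a j h
    = t * a k h + \sum_(j <- s) lam j * a j h.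
  rewrite big_cons eqxx; congr (_ + _); apply: eq_big_seq => j js.
  by case: eqP js ks => [-> ->|].
have [red|] := pselect (forall h, (forall j, j \in s -> a j h <= 0) -> c h <= 0).
  have [lam lam_ge0 cE] := IHs a c us a_lin c_lin red.
  exists (fun j => if j == k then 0 else lam j) => [j|h]; first by case: ifP.
  by rewrite sum_upd mul0r add0r.
move=> /existsNP[u /not_implyP[u_cone /negP]]; rewrite -ltNge => cu_gt0.
have aku_gt0 : 0 < a k u.
  rewrite ltNge; apply/negP => aku; move: cu_gt0; rewrite ltNge cone_le0 //.
  by move=> j; rewrite inE => /predU1P[->//|]; exact: u_cone.
pose pr (f : V -> R) h := f h - a k h / a k u * f u.
have prE f h : scalar f -> pr f h = f (h - (a k h / a k u) *: u).
  by move=> fl; rewrite scalarBZ.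
have pr_lin f : scalar f -> scalar (pr f).
  move=> fl t v w; rewrite /pr fl a_lin; ring.
have [|lam lam_ge0 cE] := IHs (fun j => pr (a j)) (pr c) us
    (fun j => pr_lin _ (a_lin j)) (pr_lin _ c_lin).
  move=> h h_cone; rewrite prE//; apply: cone_le0 => j.
  rewrite inE => /predU1P[->|js]; last by rewrite -prE //; exact: h_cone.
  by rewrite scalarBZ// divfK ?gt_eqF// subrr.
exists (fun j => if j == k then (c u - \sum_(j <- s) lam j * a j u) / a k u
                 else lam j) => [j|h].
  case: ifP => // _; rewrite divr_ge0 ?(ltW aku_gt0)// subr_ge0.
  apply: (le_trans _ (ltW cu_gt0)).
  by rewrite big_seq sumr_le0// => i si; rewrite mulr_ge0_le0 ?u_cone.
rewrite sum_upd; have := cE h; rewrite /pr => /eqP.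
rewrite subr_eq => /eqP ->.
under eq_bigr do rewrite mulrBr mulrCA.
rewrite sumrB -mulr_sumr; ring.
Qed.

(** Asking for an exact quadratic expansion of [f] along lines avoids
    derivatives: [D] is the differential of [f] at [v] and [Q] its quadratic
    part.  On the cone of directions that do not increase the active
    constraints, a small step stays feasible, so [D] is nonnegative there and
    Farkas' lemma applies to [- D]. *)
Lemma kkt (R : realFieldType) (V : lmodType R) (J : finType)
    (a : J -> V -> R) (b : J -> R) (f D Q : V -> R) (v : V) :
  (forall j, scalar (a j)) -> scalar D ->
  (forall t h, f (v + t *: h) = f v + t * D h + t ^+ 2 * Q h) ->
  (forall j, a j v <= b j) ->
  (forall w, (forall j, a j w <= b j) -> f v <= f w) ->
  exists lam : J -> R,
    [/\ forall j, 0 <= lam j,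
        forall j, lam j * (b j - a j v) = 0
      & forall h, D h + \sum_j lam j * a j h = 0].
Proof.
move=> a_lin D_lin f_exp v_feas v_min.
pose act := [pred j | a j v == b j].
have [||||lam lam_ge0 DE] := @farkas_seq R V J (enum act) a (fun h => - D h).
- exact: enum_uniq.
- exact: a_lin.
- by move=> t u w; rewrite D_lin; ring.
- move=> h h_cone; rewrite oppr_le0.
  have [e e_gt0 e_feas] : exists2 e, 0 < e &
      forall t, 0 <= t <= e -> forall j, a j (v + t *: h) <= b j.
    (* An inactive constraint tolerates steps up to its slack over the slope;
       1 is added to the denominator to keep it away from 0. *)
    pose r j := if j \in act then 1 else (b j - a j v) / (1 + `|a j h|).
    have den_gt0 j : 0 < 1 + `|a j h| by rewrite ltr_wpDr.
    have r_gt0 j : 0 < r j.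
      rewrite /r inE; case: eqP => // /eqP av.
      by rewrite divr_gt0// subr_gt0 lt_neqAle av v_feas.
    exists (\big[Order.min/1]_j r j).
      by elim/big_ind: _ => // p q p0 q0; rewrite lt_min p0.
    move=> t /andP[t_ge0 t_le] j.
    have {t_le} : t <= r j by apply: (le_trans t_le); exact: bigmin_le_cond.
    rewrite (scalarD (a_lin j)) (scalarZ (a_lin j)) /r.
    case: ifPn => [jact _|_].
      move: (jact); rewrite inE => /eqP <-.
      by rewrite gerDl mulr_ge0_le0// h_cone// mem_enum.
    rewrite ler_pdivlMr// => le_t.
    have := ler_wpM2l t_ge0 (ler_norm (a j h)); lra.
  rewrite leNgt; apply/negP => D_lt0.
  (* At this step the linear term dominates the quadratic one. *)
  pose t := Order.min e (- D h / (1 + `|Q h|)).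
  have den_gt0 : 0 < 1 + `|Q h| by rewrite ltr_wpDr.
  have t_gt0 : 0 < t by rewrite lt_min e_gt0 divr_gt0// oppr_gt0.
  have t_le : t * (1 + `|Q h|) <= - D h.
    by rewrite -ler_pdivlMr// ge_min lexx orbT.
  have : f v <= f (v + t *: h).
    by apply/v_min/e_feas; rewrite ltW//= ge_min lexx.
  rewrite f_exp.
  have -> : f v + t * D h + t ^+ 2 * Q h = f v + t * (D h + t * Q h) by ring.
  rewrite lerDl pmulr_rge0//.
  have := ler_wpM2l (ltW t_gt0) (ler_norm (Q h)); lra.
exists (fun j => if j \in act then lam j else 0); split => [j|j|h].
- by case: ifP.
- case: ifP => [|_]; last by rewrite mul0r.
  by rewrite inE => /eqP ->; rewrite subrr mulr0.
- have <- : \sum_(j <- enum act) lam j * a j h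
      = \sum_j (if j \in act then lam j else 0) * a j h.
    rewrite big_enum/= big_mkcond; apply: eq_bigr => j _.
    by case: ifP; rewrite ?mul0r.
  by rewrite -DE subrr.
Qed.

(** * Inner products and the duality gap *)

Lemma ler_term_sum (R : numDomainType) (I : finType) (F : I -> R) i :
  (forall j, 0 <= F j) -> F i <= \sum_j F j.
Proof. by move=> F_ge0; rewrite (bigD1 i)//= lerDl sumr_ge0. Qed.

Section Dot.
Variables (R : realType) (d : nat).
Implicit Types u v w : 'cV[R]_d.

Definition dot u v : R := (u^T *m v) 0 0.

Lemma dotDl u v w : dot (u + v) w = dot u w + dot v w.
Proof. by rewrite /dot raddfD mulmxDl mxE. Qed.

Lemma dotZl t u w : dot (t *: u) w = t * dot u w.
Proof. by rewrite /dot linearZ/= -scalemxAl mxE. Qed.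

Lemma dotC u v : dot u v = dot v u.
Proof. by rewrite /dot !mxE; apply: eq_bigr => p _; rewrite !mxE mulrC. Qed.

Lemma dotDr u v w : dot w (u + v) = dot w u + dot w v.
Proof. by rewrite dotC dotDl !(dotC w). Qed.

Lemma dot_sumr (I : finType) (t : I -> R) (a : I -> 'cV[R]_d) u :
  dot u (\sum_i t i *: a i) = \sum_i t i * dot u (a i).
Proof.
rewrite /dot mulmx_sumr summxE; apply: eq_bigr => i _.
by rewrite -scalemxAr mxE.
Qed.

Lemma sqnorm2E u : sqnorm2 u = dot u u.
Proof. by rewrite /dot mxE; apply: eq_bigr => p _; rewrite mxE expr2. Qed.

Lemma sqnorm2D u v : sqnorm2 (u + v) = sqnorm2 u + 2 * dot u v + sqnorm2 v.
Proof. by rewrite !sqnorm2E dotDl !dotDr (dotC v u); ring. Qed.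

Lemma sqnorm2_ge0 u : 0 <= sqnorm2 u.
Proof. by apply: sumr_ge0 => p _; exact: sqr_ge0. Qed.

Lemma coord_le_sqnorm2 u p : u p 0 ^+ 2 <= sqnorm2 u.
Proof.
exact: (ler_term_sum (F := fun q => u q 0 ^+ 2)) (fun q => sqr_ge0 (u q 0)).
Qed.

End Dot.

(** Summation by parts: node potentials against a flow on the complete
    digraph. *)
Lemma sum_flow (R : comPzRingType) (n : nat) (mu : 'M[R]_n) (t : 'I_n -> R) :
  \sum_(i < n) \sum_(j < n) mu i j * (t i - t j)
  = \sum_(i < n) t i * (\sum_(j < n) mu i j - \sum_(j < n) mu j i).
Proof.
under eq_bigr do (under eq_bigr do rewrite mulrBr; rewrite sumrB).
rewrite sumrB [X in _ - X]exchange_big -sumrB; apply: eq_bigr => i _.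
by rewrite mulrBr !mulr_sumr; congr (_ - _); apply: eq_bigr => j _; rewrite mulrC.
Qed.

Section Duality.
Variables (R : realType) (n d : nat).
Variables (x : 'I_n -> 'cV[R]_d) (y : 'I_n -> R) (tau C : R).
Variable z : 'rV[R]_d.

Local Notation slope i j := (diag_mx z *m (x j - x i)).
Local Notation comb mu i := (\sum_(j < n) mu i j *: slope i j).

(** Complementary slackness in the form of one identity.  Both weak duality and
    the optimality of a Karush-Kuhn-Tucker pair can be read off it. *)
Lemma duality_gap beta theta xi xis lam lams (mu : 'M[R]_n) :
  (forall i,
     - lam i + lams i + \sum_(j < n) mu i j - \sum_(j < n) mu j i = 0) ->
  primal_obj tau C beta xi xis - dual_obj x y z lam lams mu =
  \sum_(i < n)
    (2^-1 * sqnorm2 (beta i + comb mu i)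
     + lam i * (xi i - (y i - theta i))
     + lams i * (xis i - (theta i - y i))
     + (tau * C - lam i) * xi i + ((1 - tau) * C - lams i) * xis i)
  + \sum_(i < n) \sum_(j < n)
      mu i j * (theta j - (theta i + dot (beta i) (slope i j))).
Proof.
move=> flow.
have -> : \sum_(i < n) \sum_(j < n)
      mu i j * (theta j - (theta i + dot (beta i) (slope i j)))
    = \sum_(i < n) (- dot (beta i) (comb mu i) - theta i * (lam i - lams i)).
  rewrite sumrB sumrN -opprD.
  under [X in - (_ + X)]eq_bigr => i _.
    rewrite (_ : lam i - lams i = \sum_(j < n) mu i j - \sum_(j < n) mu j i).
      over.
    by have := flow i; lra.
  rewrite -sum_flow -big_split/= -sumrN; apply: eq_bigr => i _.
  rewrite dot_sumr -big_split/= -sumrN; apply: eq_bigr => j _; ring.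
rewrite /primal_obj /dual_obj !mulr_sumr -!big_split/= -!sumrB.
by apply: eq_bigr => i _; rewrite sqnorm2D; field.
Qed.

Lemma weak_duality beta theta xi xis lam lams (mu : 'M[R]_n) :
  primal_feasible x y z beta theta xi xis ->
  dual_feasible tau C lam lams mu ->
  dual_obj x y z lam lams mu <= primal_obj tau C beta xi xis.
Proof.
move=> [xi_ge xis_ge slopes pos] [flow lam_bd lams_bd mu_ge0].
rewrite -subr_ge0 (duality_gap beta theta xi xis flow).
apply: addr_ge0; apply: sumr_ge0 => i _.
  have [xi0 xis0] := pos i.
  have /andP[lam0 lam1] := lam_bd i; have /andP[lams0 lams1] := lams_bd i.
  by rewrite !addr_ge0// mulr_ge0 ?subr_ge0// ?invr_ge0 ?sqnorm2_ge0.
apply: sumr_ge0 => j _; rewrite mulr_ge0 ?subr_ge0//.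
by rewrite /dot mulmxA slopes.
Qed.

End Duality.

(** * The space of primal variables *)

(** With the vectors beta_i laid out as one row of length n * d, a box of primal
    variables is a product of boxes of row vectors, hence compact. *)
Section PrimalSpace.
Variables (R : realType) (n d : nat).

Local Notation pvar :=
  ('rV[R]_(n * d) * 'rV[R]_n * 'rV[R]_n * 'rV[R]_n)%type.

Implicit Types v : pvar.

Definition pbeta v i : 'cV[R]_d := (row i (vec_mx v.1.1.1))^T.
Definition ptheta v i : R := v.1.1.2 0 i.
Definition pxi v i : R := v.1.2 0 i.
Definition pxis v i : R := v.2 0 i.

Definition mkpvar (beta : 'I_n -> 'cV[R]_d) (theta xi xis : 'I_n -> R) : pvar :=
  (mxvec (\matrix_(i, p) beta i p 0), \row_i theta i, \row_i xi i, \row_i xis i).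

Lemma pbetaK beta theta xi xis : pbeta (mkpvar beta theta xi xis) =1 beta.
Proof. by move=> i; apply/colP => p; rewrite /pbeta /= mxvecK !mxE. Qed.

Lemma pthetaK beta theta xi xis : ptheta (mkpvar beta theta xi xis) =1 theta.
Proof. by move=> i; rewrite /ptheta/= mxE. Qed.

Lemma pxiK beta theta xi xis : pxi (mkpvar beta theta xi xis) =1 xi.
Proof. by move=> i; rewrite /pxi/= mxE. Qed.

Lemma pxisK beta theta xi xis : pxis (mkpvar beta theta xi xis) =1 xis.
Proof. by move=> i; rewrite /pxis/= mxE. Qed.

Lemma pbetaE v i p : pbeta v i p 0 = v.1.1.1 0 (mxvec_index i p).
Proof. by rewrite !mxE. Qed.

Lemma pbeta_lin t v w i : pbeta (t *: v + w) i = t *: pbeta v i + pbeta w i.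
Proof. by apply/colP => p; rewrite !mxE. Qed.

Lemma ptheta_lin i : scalar (ptheta ^~ i).
Proof. by move=> t v w; rewrite /ptheta/= !mxE. Qed.

Lemma pxi_lin i : scalar (pxi ^~ i).
Proof. by move=> t v w; rewrite /pxi/= !mxE. Qed.

Lemma pxis_lin i : scalar (pxis ^~ i).
Proof. by move=> t v w; rewrite /pxis/= !mxE. Qed.

Lemma pbeta_cont i p : continuous (fun v => pbeta v i p 0).
Proof.
move=> v; under eq_fun do rewrite pbetaE.
apply: (@continuous_comp _ _ _ (fun v : pvar => v.1.1.1)
  (fun b : 'rV_(n * d) => b 0 _)); last exact: coord_continuous.
apply: (@continuous_comp _ _ _ (fun v : pvar => v.1.1) fst); last exact: cvg_fst.
by apply: (@continuous_comp _ _ _ (fun v : pvar => v.1) fst); exact: cvg_fst.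
Qed.

Lemma ptheta_cont i : continuous (ptheta ^~ i).
Proof.
move=> v; apply: (@continuous_comp _ _ _ (fun v : pvar => v.1.1.2)
  (fun b : 'rV_n => b 0 i)); last exact: coord_continuous.
apply: (@continuous_comp _ _ _ (fun v : pvar => v.1.1) snd); last exact: cvg_snd.
by apply: (@continuous_comp _ _ _ (fun v : pvar => v.1) fst); exact: cvg_fst.
Qed.

Lemma pxi_cont i : continuous (pxi ^~ i).
Proof.
move=> v; apply: (@continuous_comp _ _ _ (fun v : pvar => v.1.2)
  (fun b : 'rV_n => b 0 i)); last exact: coord_continuous.
by apply: (@continuous_comp _ _ _ (fun v : pvar => v.1) snd);
  [exact: cvg_fst|exact: cvg_snd].
Qed.

Lemma pxis_cont i : continuous (pxis ^~ i).
Proof.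
move=> v; apply: (@continuous_comp _ _ _ (fun v : pvar => v.2)
  (fun b : 'rV_n => b 0 i)); [exact: cvg_snd|exact: coord_continuous].
Qed.

Lemma box_compact (c : 'I_n -> R) (r : R) :
  compact [set v : pvar |
    [/\ forall i p, - r <= pbeta v i p 0 <= r,
        forall i, c i - r <= ptheta v i <= c i + r,
        forall i, 0 <= pxi v i <= r
      & forall i, 0 <= pxis v i <= r]].
Proof.
pose box m (l u : 'I_m -> R) :=
  [set v : 'rV[R]_m | forall i, `[l i, u i]%classic (v ord0 i)].
have box_compact m l u : compact (box m l u).
  apply: (@rV_compact _ _ (fun i => `[l i, u i]%classic)) => i.
  exact: segment_compact.
rewrite (_ : mkset _ = box _ (fun=> - r) (fun=> r)
   `*` box _ (fun i => c i - r) (fun i => c i + r)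
   `*` box _ (fun=> 0) (fun=> r) `*` box _ (fun=> 0) (fun=> r)).
  by apply: compact_setX => //; apply: compact_setX => //; exact: compact_setX.
apply/seteqP; split=> v.
  move=> [vb vt vx vs]; split; last by move=> i; rewrite /= in_itv; exact: vs.
  split; last by move=> i; rewrite /= in_itv; exact: vx.
  split; last by move=> i; rewrite /= in_itv; exact: vt.
  by move=> k; case/mxvec_indexP: k => i p; rewrite /= in_itv/= -pbetaE.
move=> [[[vb vt] vx] vs]; split=> i.
- by move=> p; have := vb (mxvec_index i p); rewrite /= in_itv/= -pbetaE.
- by have := vt i; rewrite /= in_itv.
- by have := vx i; rewrite /= in_itv.
- by have := vs i; rewrite /= in_itv.
Qed.

End PrimalSpace.

Lemma continuous_sum (R : realType) (T : topologicalType) (I : finType)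
    (f : I -> T -> R) :
  (forall i, continuous (f i)) -> continuous (fun v => \sum_i f i v).
Proof.
move=> fc; apply: continuous_big => [|i _]; last exact: fc.
exact: add_continuous.
Qed.

(** * Strong duality for the inner problem *)

Section StrongDuality.
Variables (R : realType) (n d : nat).
Variables (x : 'I_n -> 'cV[R]_d) (y : 'I_n -> R) (tau C : R).
Variable z : 'rV[R]_d.
Hypotheses (tau_gt0 : 0 < tau) (tau_lt1 : tau < 1) (C_gt0 : 0 < C).

Local Notation slope i j := (diag_mx z *m (x j - x i)).
Local Notation pvar :=
  ('rV[R]_(n * d) * 'rV[R]_n * 'rV[R]_n * 'rV[R]_n)%type.
Local Notation conidx := ('I_n + 'I_n + 'I_n * 'I_n + 'I_n + 'I_n)%type.

(** The five families of constraints, in the form [con k v <= conrhs k] with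
    [con k] linear; in order: y - theta, theta - y, slopes, and the signs of xi
    and xi*. *)
Definition con (k : conidx) (v : pvar) : R :=
  match k with
  | inl (inl (inl (inl i))) => - ptheta v i - pxi v i
  | inl (inl (inl (inr i))) => ptheta v i - pxis v i
  | inl (inl (inr (i, j))) =>
      ptheta v i - ptheta v j + dot (pbeta v i) (slope i j)
  | inl (inr i) => - pxi v i
  | inr i => - pxis v i
  end.

Definition conrhs (k : conidx) : R :=
  match k with
  | inl (inl (inl (inl i))) => - y i
  | inl (inl (inl (inr i))) => y i
  | _ => 0
  end.

Definition pobj (v : pvar) := primal_obj tau C (pbeta v) (pxi v) (pxis v).

Lemma con_lin k : scalar (con k).
Proof.
case: k => [[[[i|i]|[i j]]|i]|i] t v w /=;
  rewrite ?pbeta_lin ?dotDl ?dotZl ?ptheta_lin ?pxi_lin ?pxis_lin; ring.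
Qed.

Lemma con_cont k : continuous (con k).
Proof.
have dotc i u : continuous (fun v : pvar => dot (pbeta v i) u).
  under eq_fun do rewrite /dot mxE.
  apply: continuous_sum => p v; under eq_fun do rewrite mxE.
  by apply: cvgM; [exact: pbeta_cont|exact: cvg_cst].
case: k => [[[[i|i]|[i j]]|i]|i] v /=.
- by apply: cvgB; [apply: cvgN; exact: ptheta_cont|exact: pxi_cont].
- by apply: cvgB; [exact: ptheta_cont|exact: pxis_cont].
- apply: cvgD; last exact: dotc.
  by apply: cvgB; exact: ptheta_cont.
- by apply: cvgN; exact: pxi_cont.
- by apply: cvgN; exact: pxis_cont.
Qed.

Lemma pobj_cont : continuous pobj.
Proof.
move=> v; apply: cvgD; apply: cvgM; try exact: cvg_cst.
  apply: continuous_sum => i; apply: continuous_sum => p w.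
  under eq_fun do rewrite expr2.
  by apply: cvgM; exact: pbeta_cont.
apply: continuous_sum => i w.
by apply: cvgD; apply: cvgM; try exact: cvg_cst;
  [exact: pxi_cont|exact: pxis_cont].
Qed.

Lemma con_feasible v : (forall k, con k v <= conrhs k) <->
  primal_feasible x y z (pbeta v) (ptheta v) (pxi v) (pxis v).
Proof.
split=> [feas|[xi_ge xis_ge slopes pos]].
  split=> [i|i|i j|i].
  - by have /= := feas (inl (inl (inl (inl i)))); lra.
  - by have /= := feas (inl (inl (inl (inr i)))); lra.
  - by have /= := feas (inl (inl (inr (i, j)))); rewrite /dot mulmxA; lra.
  - have /= := feas (inl (inr i)); have /= := feas (inr i); lra.
case=> [[[[i|i]|[i j]]|i]|i] /=.
- by have := xi_ge i; lra.
- by have := xis_ge i; lra.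
- by have := slopes i j; rewrite /dot mulmxA; lra.
- by have [] := pos i; lra.
- by have [] := pos i; lra.
Qed.

Lemma pobj_expand v t h : pobj (v + t *: h) = pobj v
  + t * (\sum_i (dot (pbeta v i) (pbeta h i)
         + C * (tau * pxi h i + (1 - tau) * pxis h i)))
  + t ^+ 2 * (2^-1 * \sum_i sqnorm2 (pbeta h i)).
Proof.
rewrite /pobj /primal_obj !mulr_sumr -!big_split; apply: eq_bigr => i _.
rewrite [v + _]addrC pbeta_lin pxi_lin pxis_lin /=.
rewrite addrC sqnorm2D !sqnorm2E !dotZl !(dotC _ (t *: _)) !dotZl.
by rewrite (dotC (pbeta h i) (pbeta v i)); field.
Qed.

(** The summands 2 M + 1, M / (C tau) and M / (C (1 - tau)) bound beta, xi and
    xi* respectively; the first is 2 M + 1 since the norm of beta_i squared is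
    at most 2 M <= (2 M + 1) ^ 2. *)
Lemma sublevel_bounded M v :
  (forall k, con k v <= conrhs k) -> pobj v <= M ->
  let r := 2 * M + 1 + M / (C * tau) + M / (C * (1 - tau)) in
  [/\ forall i p, - r <= pbeta v i p 0 <= r,
      forall i, y i - r <= ptheta v i <= y i + r,
      forall i, 0 <= pxi v i <= r & forall i, 0 <= pxis v i <= r].
Proof.
move=> /con_feasible[xi_ge xis_ge _ pos] v_le r.
have taus_gt0 : 0 < 1 - tau by rewrite subr_gt0.
have pen_ge0 i : 0 <= tau * pxi v i + (1 - tau) * pxis v i.
  by have [? ?] := pos i; rewrite addr_ge0// mulr_ge0// ltW.
have nrm_le i : 2^-1 * sqnorm2 (pbeta v i) <= M.
  apply: le_trans v_le; apply: (@le_trans _ _ (2^-1 * \sum_i sqnorm2 (pbeta v i))).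
    rewrite ler_wpM2l ?invr_ge0//.
    exact: ler_term_sum (fun j => sqnorm2_ge0 (pbeta v j)).
  by rewrite lerDl mulr_ge0 ?(ltW C_gt0)// sumr_ge0.
have pen_le i : C * (tau * pxi v i + (1 - tau) * pxis v i) <= M.
  apply: le_trans v_le.
  apply: (@le_trans _ _ (C * \sum_i (tau * pxi v i + (1 - tau) * pxis v i))).
    by rewrite ler_wpM2l ?(ltW C_gt0)//; exact: ler_term_sum pen_ge0.
  rewrite lerDr mulr_ge0// sumr_ge0// => j _; exact: sqnorm2_ge0.
have xi_le i : pxi v i <= M / (C * tau).
  rewrite ler_pdivlMr ?mulr_gt0//; apply: le_trans (pen_le i).
  have [_ xis0] := pos i.
  have := mulr_ge0 (ltW C_gt0) (mulr_ge0 (ltW taus_gt0) xis0); lra.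
have xis_le i : pxis v i <= M / (C * (1 - tau)).
  rewrite ler_pdivlMr ?mulr_gt0//; apply: le_trans (pen_le i).
  have [xi0 _] := pos i.
  have := mulr_ge0 (ltW C_gt0) (mulr_ge0 (ltW tau_gt0) xi0); lra.
have M_ge0 : 0 <= M.
  apply: le_trans v_le; rewrite addr_ge0// mulr_ge0 ?(ltW C_gt0)//.
    by apply: sumr_ge0 => i _; exact: sqnorm2_ge0.
  exact: sumr_ge0.
have M1_ge0 : 0 <= M / (C * tau) by rewrite divr_ge0// mulr_ge0 ?ltW.
have M2_ge0 : 0 <= M / (C * (1 - tau)) by rewrite divr_ge0// mulr_ge0 ?ltW.
split=> [i p|i|i|i].
- have b_le : pbeta v i p 0 ^+ 2 <= (2 * M + 1) ^+ 2.
    have := coord_le_sqnorm2 (pbeta v i) p; have := nrm_le i.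
    by have := sqr_ge0 M; nra.
  rewrite -ler_norml; apply: (@le_trans _ _ (2 * M + 1)); last by rewrite /r; lra.
  by rewrite -ler_sqr ?nnegrE ?real_normK ?num_real//; lra.
- have := xi_ge i; have := xis_ge i; have := xi_le i; have := xis_le i.
  by rewrite /r => *; apply/andP; split; lra.
- have [-> _] := pos i; have := xi_le i; rewrite /r; lra.
- have [_ ->] := pos i; have := xis_le i; rewrite /r; lra.
Qed.

(** The point with beta = theta = 0 and xi_i = xi*_i = |y_i| is feasible, so
    only the sublevel set of its value matters, and that set lies in a compact
    box. *)
Lemma primal_attained : exists2 v, (forall k, con k v <= conrhs k) &
  forall w, (forall k, con k w <= conrhs k) -> pobj v <= pobj w.
Proof.
pose base : pvar :=
  mkpvar (fun=> 0) (fun=> 0) (fun i => `|y i|) (fun i => `|y i|).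
have base_feas k : con k base <= conrhs k.
  move: k; apply/con_feasible; split=> [i|i|i j|i].
  - by rewrite pthetaK pxiK subr0 ler_norm.
  - by rewrite pthetaK pxisK sub0r -normrN ler_norm.
  - by rewrite !pthetaK pbetaK trmx0 !mul0mx mxE addr0.
  - by rewrite pxiK pxisK.
pose feas := [set v | forall k, con k v <= conrhs k].
pose r := 2 * pobj base + 1 + pobj base / (C * tau)
          + pobj base / (C * (1 - tau)).
pose box := [set v : pvar |
    [/\ forall i p, - r <= pbeta v i p 0 <= r,
        forall i, y i - r <= ptheta v i <= y i + r,
        forall i, 0 <= pxi v i <= r & forall i, 0 <= pxis v i <= r]].
have cK : compact (box `&` feas).
  apply: compact_closedI; first exact: box_compact.
  rewrite (_ : feas = \bigcap_k con k @^-1` [set t | t <= conrhs k]).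
    apply: closed_bigI => k _; apply: preimage_closed; last exact: closed_le.
    by move=> v _; exact: con_cont.
  by apply/seteqP; split=> [v h k _|v h k]; exact: h.
have in_box w : feas w -> pobj w <= pobj base -> box w.
  by move=> w_feas /(sublevel_bounded w_feas).
have [||v] := @compact_EVT_min _ _ pobj _ _ cK.
- by exists base; split=> //; exact: in_box.
- by apply: continuous_subspaceT; exact: pobj_cont.
rewrite inE => -[_ v_feas] v_min; exists v => // w w_feas.
have [w_le|/ltW base_le] := leP (pobj w) (pobj base).
  by apply: v_min; rewrite inE; split=> //; exact: in_box.
apply: le_trans base_le; apply: v_min; rewrite inE; split=> //.
exact: in_box.
Qed.

(** The Lagrangian at the multipliers of [kkt] has zero gradient; its
    components say that beta_i is minus the mu-combination of the slopes, that
    the flow equation holds, and that the multipliers of the signs of xi and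
    xi* are the slacks of the upper bounds on lambda and lambda*. *)
Lemma optimal_pair : exists beta theta xi xis lam lams mu,
  [/\ primal_feasible x y z beta theta xi xis,
      dual_feasible tau C lam lams mu
    & primal_obj tau C beta xi xis = dual_obj x y z lam lams mu].
Proof.
have [v v_feas v_min] := primal_attained.
pose D h := \sum_i (dot (pbeta v i) (pbeta h i)
                    + C * (tau * pxi h i + (1 - tau) * pxis h i)).
have D_lin : scalar D.
  move=> t u w; rewrite /D mulr_sumr -big_split; apply: eq_bigr => i _ /=.
  by rewrite pbeta_lin dotDr (dotC _ (t *: _)) dotZl pxi_lin pxis_lin
    (dotC (pbeta u i)); ring.
have [m [m_ge0 m_slack m_stat]] :=
  kkt con_lin D_lin (pobj_expand v) v_feas v_min.
pose lam i := m (inl (inl (inl (inl i)))).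
pose lams i := m (inl (inl (inl (inr i)))).
pose mu : 'M[R]_n := \matrix_(i, j) m (inl (inl (inr (i, j)))).
pose rho i := m (inl (inr i)).
pose rhos i := m (inr i).
pose w i := \sum_(j < n) mu i j *: slope i j.
pose gtheta i := - lam i + lams i + \sum_(j < n) mu i j - \sum_(j < n) mu j i.
pose gxi i := tau * C - lam i - rho i.
pose gxis i := (1 - tau) * C - lams i - rhos i.
have stat h : D h + \sum_k m k * con k h =
  \sum_i (dot (pbeta v i + w i) (pbeta h i) + gtheta i * ptheta h i
          + gxi i * pxi h i + gxis i * pxis h i).
  rewrite !big_sumType/=.
  pose F i j := mu i j
    * (ptheta h i - ptheta h j + dot (pbeta h i) (slope i j)).
  rewrite [X in _ + X + _ + _](_ : _ = \sum_i (dot (w i) (pbeta h i)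
      + ptheta h i * (\sum_(j < n) mu i j - \sum_(j < n) mu j i))).
    rewrite -!big_split/=; apply: eq_bigr => i _.
    by rewrite dotDl /gtheta /gxi /gxis /lam /lams /rho /rhos; ring.
  rewrite (eq_bigr (fun k => F k.1 k.2)); last first.
    by case=> i j _; rewrite /F mxE.
  rewrite -(pair_bigA _ F) big_split/= -sum_flow -big_split/=.
  apply: eq_bigr => i _; rewrite dotC dot_sumr -big_split/=.
  by apply: eq_bigr => j _; rewrite /F; ring.
(* Taking the gradient itself as the direction makes the stationarity
   condition a vanishing sum of squares. *)
have grad0 i : sqnorm2 (pbeta v i + w i) + gtheta i ^+ 2 + gxi i ^+ 2
    + gxis i ^+ 2 = 0.
  pose h := mkpvar (fun i => pbeta v i + w i) gtheta gxi gxis.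
  have := m_stat h; rewrite stat; under eq_bigr do
    rewrite pbetaK pthetaK pxiK pxisK -sqnorm2E -!expr2.
  move/eqP; rewrite psumr_eq0 => [/allP/(_ i (mem_index_enum _))/eqP //|j _].
  by rewrite !addr_ge0 ?sqr_ge0 ?sqnorm2_ge0.
have grads i : [/\ sqnorm2 (pbeta v i + w i) = 0, gtheta i = 0, gxi i = 0
                 & gxis i = 0].
  have := grad0 i; have := sqnorm2_ge0 (pbeta v i + w i).
  have := sqr_ge0 (gtheta i); have := sqr_ge0 (gxi i).
  have := sqr_ge0 (gxis i) => g3 g2 g1 g0 gsum.
  by split; [lra| | |]; apply/eqP; rewrite -sqrf_eq0; apply/eqP; lra.
have flow i : gtheta i = 0 by have [] := grads i.
have rhoE i : rho i = tau * C - lam i.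
  by have [_ _ + _] := grads i; rewrite /gxi; lra.
have rhosE i : rhos i = (1 - tau) * C - lams i.
  by have [_ _ _] := grads i; rewrite /gxis; lra.
exists (pbeta v), (ptheta v), (pxi v), (pxis v), lam, lams, mu; split.
- exact/con_feasible.
- split=> [//|i|i|i j]; last by rewrite mxE.
  + by rewrite m_ge0/= -subr_ge0 -rhoE m_ge0.
  + by rewrite m_ge0/= -subr_ge0 -rhosE m_ge0.
apply/eqP; rewrite -subr_eq0.
rewrite (duality_gap x y tau C z (pbeta v) (ptheta v) (pxi v) (pxis v) flow); apply/eqP.
rewrite [X in X + _]big1 ?[X in _ + X]big1 ?addr0// => i _.
  apply: big1 => j _; have := m_slack (inl (inl (inr (i, j)))).
  by rewrite /mu mxE /= => <-; ring.
rewrite -rhoE -rhosE; have [-> _ _ _] := grads i.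
have s1 := m_slack (inl (inl (inl (inl i)))).
have s2 := m_slack (inl (inl (inl (inr i)))).
have s3 := m_slack (inl (inr i)); have s4 := m_slack (inr i).
rewrite /= -/(lam i) in s1; rewrite /= -/(lams i) in s2.
rewrite /= -/(rho i) in s3; rewrite /= -/(rhos i) in s4.
by lra.
Qed.

End StrongDuality.

(** * Values of the inner problems *)

Lemma inf_is_min (R : realType) (A : set R) v : is_min A v -> inf A = v.
Proof.
move=> [Av lbv]; apply/le_anti; rewrite ge_inf//=; last by exists v.
by apply: lb_le_inf => //; exists v.
Qed.

Lemma sup_is_max (R : realType) (A : set R) v : is_max A v -> sup A = v.
Proof.
move=> [Av ubv]; apply/le_anti; rewrite ub_le_sup ?andbT//; last by exists v.
by apply: ge_sup => //; exists v.
Qed.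

Lemma strong_duality (R : realType) (n d : nat)
    (x : 'I_n -> 'cV[R]_d) (y : 'I_n -> R) (tau C : R) (z : 'rV[R]_d) :
  0 < tau -> tau < 1 -> 0 < C ->
  [/\ is_min (primal_values x y tau C z) (g_primal x y tau C z),
      is_max (dual_values x y tau C z) (g_dual x y tau C z)
    & g_primal x y tau C z = g_dual x y tau C z].
Proof.
move=> tau_gt0 tau_lt1 C_gt0.
have [beta [theta [xi [xis [lam [lams [mu [pfeas dfeas pdE]]]]]]]] :=
  optimal_pair x y z tau_gt0 tau_lt1 C_gt0.
have pmin : is_min (primal_values x y tau C z) (primal_obj tau C beta xi xis).
  split; first by exists beta, theta, xi, xis.
  move=> _ [b [t [e [es [feas ->]]]]]; rewrite pdE.
  exact: weak_duality feas dfeas.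
have dmax : is_max (dual_values x y tau C z) (dual_obj x y z lam lams mu).
  split; first by exists lam, lams, mu.
  move=> _ [l [ls [m [feas ->]]]]; rewrite -pdE.
  exact: weak_duality pfeas feas.
by rewrite /g_primal /g_dual (inf_is_min pmin) (sup_is_max dmax).
Qed.

(** * The dual objective as an affine function of z *)

Section LinearizedDual.
Variables (R : realType) (n d : nat).
Variables (x : 'I_n -> 'cV[R]_d) (y : 'I_n -> R).

Local Notation wcomb mu i := (\sum_(j < n) mu i j *: (x j - x i)).

Lemma dual_objE z lam lams (mu : 'M[R]_n) : dual_obj x y z lam lams mu
  = - 2^-1 * \sum_i \sum_(p < d) z 0 p ^+ 2 * wcomb mu i p 0 ^+ 2
    + \sum_(i < n) lam i * y i - \sum_(i < n) lams i * y i.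
Proof.
rewrite /dual_obj; congr (_ * _ + _ - _); apply: eq_bigr => i _.
under eq_bigr do rewrite scalemxAr.
rewrite -mulmx_sumr /sqnorm2; apply: eq_bigr => p _.
by rewrite mul_diag_mx mxE exprMn.
Qed.

Lemma dual_obj_linE z lam lams (mu : 'M[R]_n) : dual_obj_lin x y z lam lams mu
  = - 2^-1 * \sum_i \sum_(p < d) z 0 p * wcomb mu i p 0 ^+ 2
    + \sum_(i < n) lam i * y i - \sum_(i < n) lams i * y i.
Proof.
rewrite /dual_obj_lin; congr (_ * _ + _ - _); apply: eq_bigr => i _ /=.
rewrite mul_mx_diag mxE; apply: eq_bigr => p _; rewrite !mxE; ring.
Qed.

Lemma dual_obj_lin_binary (k : nat) z lam lams (mu : 'M[R]_n) :
  @sparse_binary R d k z ->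
  dual_obj_lin x y z lam lams mu = dual_obj x y z lam lams mu.
Proof.
move=> [z01 _]; rewrite dual_objE dual_obj_linE; congr (_ * _ + _ - _).
apply: eq_bigr => i _; apply: eq_bigr => p _; congr (_ * _).
by case: (z01 p) => ->; rewrite ?expr0n ?expr1n.
Qed.

Lemma dual_obj_lin_affine z z' t lam lams (mu : 'M[R]_n) :
  dual_obj_lin x y (t *: z + (1 - t) *: z') lam lams mu
  = t * dual_obj_lin x y z lam lams mu
    + (1 - t) * dual_obj_lin x y z' lam lams mu.
Proof.
rewrite !dual_obj_linE.
rewrite (_ : \sum_i _ = t * \sum_i \sum_(p < d) z 0 p * wcomb mu i p 0 ^+ 2
    + (1 - t) * \sum_i \sum_(p < d) z' 0 p * wcomb mu i p 0 ^+ 2).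
  by ring.
rewrite !mulr_sumr -big_split; apply: eq_bigr => i _.
rewrite !mulr_sumr -big_split; apply: eq_bigr => p _ /=.
by rewrite !mxE; ring.
Qed.

(** Splitting z_p w_p ^ 2 as (sqrt z_p w_p) ^ 2 makes the linear form the dual
    objective of an ordinary instance, so that strong duality covers it. *)
Lemma dual_obj_lin_scaled z lam lams (mu : 'M[R]_n) :
  unit_box z -> dual_obj_lin x y z lam lams mu =
  dual_obj (fun i => diag_mx (map_mx Num.sqrt z) *m x i) y (const_mx 1)
    lam lams mu.
Proof.
move=> zbox; rewrite dual_obj_linE /dual_obj; congr (_ * _ + _ - _).
apply: eq_bigr => i _.
under [X in _ = sqnorm2 X]eq_bigr do
  rewrite diag_const_mx mul1mx -mulmxBr scalemxAr.
rewrite -mulmx_sumr; apply: eq_bigr => p _.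
have /andP[z_ge0 _] := zbox p.
by rewrite mul_diag_mx [X in _ = X ^+ 2]mxE mxE exprMn sqr_sqrtr.
Qed.

End LinearizedDual.

Lemma g_dual_lin_max (R : realType) (n d : nat)
    (x : 'I_n -> 'cV[R]_d) (y : 'I_n -> R) (tau C : R) (z : 'rV[R]_d) :
  0 < tau -> tau < 1 -> 0 < C -> unit_box z ->
  is_max (dual_values_lin x y tau C z) (g_dual_lin x y tau C z).
Proof.
move=> tau_gt0 tau_lt1 C_gt0 zbox; rewrite /g_dual_lin.
pose x' i := diag_mx (map_mx Num.sqrt z) *m x i.
have -> : dual_values_lin x y tau C z = dual_values x' y tau C (const_mx 1).
  apply/seteqP; split=> _ [lam [lams [mu [feas ->]]]];
    by exists lam, lams, mu; rewrite dual_obj_lin_scaled.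
by have [] := strong_duality x' y (const_mx 1) tau_gt0 tau_lt1 C_gt0.
Qed.

(** * The outer problem *)

Lemma finite_sparse_binary (R : realType) (d k : nat) :
  finite_set (@sparse_binary R d k).
Proof.
pose bits (b : {ffun 'I_d -> bool}) : 'rV[R]_d := \row_p (b p)%:R.
apply: (@sub_finite_set _ _ (bits @` setT)); last exact: finite_image.
move=> z [z01 _]; exists [ffun p => z 0 p == 1] => //.
apply/rowP => p; rewrite mxE ffunE.
by case: (z01 p) => ->; rewrite ?eqxx// eq_sym oner_eq0.
Qed.

Lemma finite_set_min (R : realType) (A : set R) :
  finite_set A -> A !=set0 -> exists v, is_min A v.
Proof.
move=> finA A0.
have [|v] := @compact_EVT_min R R id A A0 (finite_compact finA).
  by apply: continuous_subspaceT => u; exact: cvg_id.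
rewrite inE => Av v_min; exists v; split=> // u Au.
by apply: v_min; rewrite inE.
Qed.

Unset Implicit Arguments.

Theorem theorem2 (R : realType) (n d k : nat)
    (x : 'I_n -> 'cV[R]_d) (y : 'I_n -> R) (tau C : R)
    (tau_gt0 : 0 < tau) (tau_lt1 : tau < 1) (C_gt0 : 0 < C) :
  let S := @sparse_binary R d k in
  let gP := g_primal x y tau C in
  let gD := g_dual x y tau C in
  let gL := g_dual_lin x y tau C in
  (* both inner problems attain their optimum, with the same value *)
  (forall z, S z ->
     [/\ is_min (primal_values x y tau C z) (gP z),
         is_max (dual_values x y tau C z) (gD z)
       & gP z = gD z]) /\
  (* the outer problems have the same optimal value and the same solutions *)
  ((exists v, is_min (gP @` S) v /\ is_min (gD @` S) v) /\
   argmin S gP = argmin S gD) /\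
  (* on S the dual objective is given by a convex function *)
  [/\ forall z, S z -> gL z = gD z,
      forall z, unit_box z -> is_max (dual_values_lin x y tau C z) (gL z)
    & convex_function (@unit_box R d) gL].
Proof.
move=> S gP gD gL.
have gPD : gP = gD.
  by apply/funext => z; have [] := strong_duality x y z tau_gt0 tau_lt1 C_gt0.
split; first by move=> z _; exact: strong_duality.
split.
  rewrite gPD; split=> //.
  have [||v v_min] := @finite_set_min R (gD @` S); last by exists v.
    exact/finite_image/finite_sparse_binary.
  exists (gD 0), 0 => //; split=> [p|]; first by left; rewrite mxE.
  by rewrite big1 ?ler0n// => p _; rewrite mxE.
have gL_max z : unit_box z -> is_max (dual_values_lin x y tau C z) (gL z).
  exact: g_dual_lin_max.
split=> [z Sz|//|t z z'].
  rewrite /gL /gD /g_dual_lin /g_dual; congr (sup _).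
  by apply/seteqP; split=> _ [lam [lams [mu [feas ->]]]];
    exists lam, lams, mu; rewrite (dual_obj_lin_binary _ _ _ _ _ Sz).
rewrite !inE => z_box z'_box.
have t_ge0 : 0 <= t%:num by [].
have t'_ge0 : 0 <= 1 - t%:num by rewrite subr_ge0.
have zz'_box : unit_box (t%:num *: z + (1 - t%:num) *: z').
  move=> p; rewrite !mxE; have /andP[z0 z1] := z_box p.
  have /andP[z'0 z'1] := z'_box p.
  rewrite addr_ge0 ?mulr_ge0//=.
  have := ler_wpM2l t_ge0 z1; have := ler_wpM2l t'_ge0 z'1; lra.
have [[lam [lams [mu [feas gE]]]] _] := gL_max _ zz'_box.
have -> : gL (conv t z z') = gL (t%:num *: z + (1 - t%:num) *: z') by [].
rewrite gE dual_obj_lin_affine convRE.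
have [_ ub] := gL_max _ z_box; have [_ ub'] := gL_max _ z'_box.
apply: lerD; apply: ler_wpM2l => //; [apply: ub|apply: ub'];
  by exists lam, lams, mu.
Qed.
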